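(* Let $\Lambda:\mathbb{R}\to[0,1]$ be a right-continuous decreasing function and define $T_\Lambda:\mathbb{R}\times\mathbb{R}\times L^\infty\to(-\infty,\infty]$ by $$T_\Lambda(a,x,X)=\mathbb E\left[a+\frac{1}{1-\Lambda(x)}(X-a)_+\right]\vee x.$$ Then $$\mathrm{ES}_\Lambda(X)=\min_{(a,x)\in\mathbb{R}^2}T_\Lambda(a,x,X),\quad X\in L^\infty,$$ where the minimum is attained at $x^*=\mathrm{ES}_\Lambda(X)$ and any $a^*\in[\mathrm{VaR}_{\Lambda(x^* )}(X),\mathrm{VaR}^+_{\Lambda(x^* )}(X)]$ if $\Lambda(x^* )\in[0,1)$, or $a^*=\mathrm{VaR}_1(X)$ if $\Lambda(x^* )=1$. Moreover: (i) $T_\Lambda(a,x,X)$ is jointly convex in $(a,X)\in\mathbb{R}\times L^\infty$ for every $x\in\mathbb{R}$; (ii) $T_\Lambda(a,x,X)$ is convex in $x\in\mathbb{R}$ for all $(a,X)\in\mathbb{R}\times L^\infty$ if and only if $x\mapsto1/(1-\Lambda(x))$ is convex; (iii) the following are equivalent: (a) $T_\Lambda$ is jointly convex in $(a,x)\in\mathbb{R}^2$ for all $X\in L^\infty$; (b) $T_\Lambda$ is jointly quasi-convex in $(a,x)\in\mathbb{R}^2$ for all $X\in L^\infty$; (c) $T_\Lambda$ is jointly convex in $(a,x,X)\in\mathbb{R}\times\mathbb{R}\times L^\infty$; (d) $T_\Lambda$ is jointly quasi-convex in $(a,x,X)\in\mathbb{R}\times\mathbb{R}\times L^\infty$; (e)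 $\Lambda$ is constant on $\mathbb{R}$.
   Context: $(\Omega,\mathcal F,\mathbb P)$ is an atomless probability space, $L^0$ all random variables, $L^\infty$ essentially bounded ones; ''decreasing'' is weak; $\wedge=\min$, $\vee=\max$, $y_+=\max\{y,0\}$. In $\frac{1}{1-\Lambda(x)}\mathbb E[(X-a)_+]$ the conventions $0/0=0$ and $c/0=\infty$ for $c>0$ are used. For $\alpha\in[0,1]$, $X\in L^0$: $\mathrm{VaR}_\alpha(X)=\inf\{x\in\mathbb{R}:\mathbb P(X\le x)\ge\alpha\}$, $\mathrm{VaR}^+_\alpha(X)=\inf\{x\in\mathbb{R}:\mathbb P(X\le x)>\alpha\}$. For $X\in L^\infty$: $\mathrm{ES}_\alpha(X)=\frac{1}{1-\alpha}\int_\alpha^1\mathrm{VaR}_\beta(X)\,\mathrm d\beta$ for $\alpha<1$, $\mathrm{ES}_1(X)=\mathrm{VaR}_1(X)$; for decreasing $\Lambda:\mathbb{R}\to[0,1]$, $\mathrm{ES}_\Lambda(X)=\sup_{x\in\mathbb{R}}\left(\mathrm{ES}_{\Lambda(x)}(X)\wedge x\right)$. *)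

(* Defs.v *)
From HB Require Import structures.
From mathcomp Require Import all_boot all_order all_algebra.
From mathcomp Require Import all_classical all_reals all_analysis.
Set Implicit Arguments. Unset Strict Implicit. Unset Printing Implicit Defensive.
Import Order.TTheory GRing.Theory Num.Theory.
Import numFieldNormedType.Exports.
Local Open Scope classical_set_scope.
Local Open Scope ring_scope.

Section Defs.
Context (d : measure_display) (Omega : measurableType d) (R : realType)
        (P : probability Omega R).

Definition atomless : Prop :=
  forall A : set Omega, measurable A -> (0 < P A)%E ->
    exists B : set Omega, [/\ measurable B, B `<=` A & (0 < P B)%E /\ (P B < P A)%E].

Definition Linf : set (Omega -> R) :=
  [set X : Omega -> R | measurable_fun setT X /\ exists M : R, {ae P, forall w, `|X w| <= M}].

Definition VaR (X : Omega -> R) (alpha : R) : \bar R :=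
  ereal_inf [set x%:E | x in [set x : R | (alpha%:E <= P [set w | (X w <= x)%R])%E]].

Definition VaRp (X : Omega -> R) (alpha : R) : \bar R :=
  ereal_inf [set x%:E | x in [set x : R | (alpha%:E < P [set w | (X w <= x)%R])%E]].

Definition ES (X : Omega -> R) (alpha : R) : \bar R :=
  if alpha < 1 then
    (((1 - alpha)^-1)%:E *
      \int[@lebesgue_measure R]_(b in `[alpha, 1%R]) VaR X b)%E
  else VaR X 1.

Definition ESL (Lam : R -> R) (X : Omega -> R) : \bar R :=
  ereal_sup [set Order.min (ES X (Lam x)) x%:E | x in [set: R]].

Definition Epos (X : Omega -> R) (a : R) : \bar R :=
  (\int[P]_w (Num.max (X w - a) 0)%:E)%E.

(* e / c with conventions 0/0 = 0 and e/0 = +oo for e > 0 (used with c >= 0) *)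
Definition divE (e : \bar R) (c : R) : \bar R :=
  if c != 0 then (e * (c^-1)%:E)%E
  else if e == 0%E then 0%E else +oo%E.

Definition TL (Lam : R -> R) (a x : R) (X : Omega -> R) : \bar R :=
  Order.max (a%:E + divE (Epos X a) (1 - Lam x))%E x%:E.

End Defs.

Definition ccomb (R : realType) (t u v : R) : R := t * u + (1 - t) * v.
Definition ccombf (T : Type) (R : realType) (t : R) (U V : T -> R) : T -> R :=
  fun w => t * U w + (1 - t) * V w.

Definition invOneMinus (R : realType) (Lam : R -> R) (x : R) : \bar R :=
  if Lam x != 1 then ((1 - Lam x)^-1)%:E else +oo%E.

Definition convexE (R : realType) (f : R -> \bar R) : Prop :=
  forall (u v t : R), 0 < t < 1 ->
    (f (ccomb t u v) <= t%:E * f u + (1 - t)%:E * f v)%E.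

(* Main.v *)
(* Under Lebesgue measure on [0, 1] the quantile function of X has the law of X, so
   (1 - al) ES_al(X) is the integral of the quantile over [al, 1]; comparing it with
   the integral of (quantile - a)_+ gives the Rockafellar-Uryasev inequality
   ES_al(X) <= a + E(X - a)_+ / (1 - al) with its equality case.  The function
   x |-> ES_{Lam x}(X) is decreasing, and right-continuous because Lam is
   right-continuous and decreasing while ES_al is left-continuous in al.  Hence
   xs = ES_Lam(X) is where it crosses the diagonal: max(ES_{Lam x}(X), x) is at
   least xs for every x, with equality at x = xs.

   For the convexity part, {T_Lam <= r} is the set where x <= r, a <= r and
   E(X - a)_+ <= (r - a)(1 - Lam x).  Constant X suffice for both converses:
   quasi-convexity makes (1 - Lam)/Lam concave, and an increasing concave function
   on the line that is bounded below is constant. *)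

Require Import Defs.
From HB Require Import structures.
From mathcomp Require Import all_boot all_order all_algebra.
From mathcomp Require Import all_classical all_reals all_analysis.
From mathcomp Require Import measurable_realfun ring lra.
Import Order.TTheory GRing.Theory Num.Theory.
Import numFieldNormedType.Exports.
Local Open Scope classical_set_scope.
Local Open Scope ring_scope.

(** * Distribution function and quantiles of an essentially bounded variable *)

Section Quantile.
Set Implicit Arguments.
Unset Strict Implicit.
Context (d : measure_display) (Omega : measurableType d) (R : realType)
  (P : probability Omega R) (X : Omega -> R) (M : R)
  (mX : measurable_fun setT X) (XM : {ae P, forall w, `|X w| <= M}).

Local Notation F y := (P [set w | (X w <= y)%R]).

Let Xm : {mfun Omega >-> R} :=
  HB.pack X (@isMeasurableFun.Build _ _ _ _ X mX).

Lemma measurable_le_cst (y : R) : measurable [set w | X w <= y].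
Proof.
have := mX measurableT (measurable_itv `]-oo, y]).
by rewrite setTI; congr measurable; apply/seteqP; split => w /=; rewrite in_itv.
Qed.

Lemma cdfE y : cdf (Xm : {RV P >-> R}) y = F y.
Proof.
by rewrite /cdf /distribution /pushforward; congr (P _);
  apply/seteqP; split => w /=; rewrite in_itv.
Qed.

Lemma cdf_homo y z : y <= z -> (F y <= F z)%E.
Proof. by move=> yz; rewrite -!cdfE; apply: cdf_nondecreasing. Qed.

Lemma cdf_fin y : (fine (F y))%:E = F y.
Proof. by rewrite fineK// fin_num_measure//; exact: measurable_le_cst. Qed.

Lemma cdf_bounds y : 0 <= fine (F y) <= 1.
Proof.
rewrite -!lee_fin cdf_fin measure_ge0/=.
by apply: probability_le1; exact: measurable_le_cst.
Qed.

Lemma cdf_lt_bound_eq0 y : y < - M -> F y = 0%E.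
Proof.
move=> yM; apply/negligibleP; first exact: measurable_le_cst.
apply: negligibleS XM => w /= Xwy XwM; move: XwM; rewrite ler_norml; lra.
Qed.

Lemma cdf_bound_eq1 : F M = 1%E.
Proof.
have H : P (~` [set w | X w <= M]) = 0%E.
  apply/negligibleP; first by apply: measurableC; exact: measurable_le_cst.
  apply: negligibleS XM => w /= Xwy XwM; apply: Xwy.
  by rewrite (le_trans (ler_norm _)).
have := probability_setC P (measurable_le_cst M); rewrite H -/(F M) -cdf_fin.
by rewrite -EFinB => -[/eqP]; rewrite eq_sym subr_eq0 => /eqP <-.
Qed.

Lemma VaR_homo (a b : R) : a <= b -> (VaR P X a <= VaR P X b)%E.
Proof.
move=> ab; apply: ereal_inf_le_tmp => _ [y /= yb <-]; exists y => //=.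
by apply: le_trans yb; rewrite lee_fin.
Qed.

Lemma VaR_leM (b : R) : b <= 1 -> (VaR P X b <= M%:E)%E.
Proof.
move=> b1; apply: ereal_inf_lbound; exists M => //=.
by rewrite cdf_bound_eq1; rewrite lee_fin.
Qed.

Lemma VaR_geNM (b : R) : 0 < b -> ((- M)%:E <= VaR P X b)%E.
Proof.
move=> b0; apply: le_ereal_inf_tmp => _ [y /= yb <-]; rewrite lee_fin leNgt.
apply/negP => yM; move: yb; rewrite cdf_lt_bound_eq0//.
by rewrite lee_fin; lra.
Qed.

(* Right-continuity of the distribution function makes the infimum attained. *)
Lemma VaR_le_cdf (b y : R) : (VaR P X b <= y%:E)%E <-> (b%:E <= F y)%E.
Proof.
split=> [Vy|by']; last by apply: ereal_inf_lbound; exists y.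
rewrite -cdfE; apply: (cvge_to_ge (@cdf_right_continuous _ _ _ P Xm y)).
near=> z; rewrite cdfE.
have /ereal_inf_lt[_ [u /= bu <-]] : (VaR P X b < z%:E)%E.
  by apply: (le_lt_trans Vy); rewrite lte_fin; near: z; exact: nbhs_right_gt.
by rewrite lte_fin => /ltW /cdf_homo; apply: le_trans.
Unshelve. all: by end_near. Qed.

End Quantile.

(** * [ES] and [Epos] as integrals of the quantile function *)

Section QuantileIntegral.
Set Implicit Arguments.
Unset Strict Implicit.
Context (d : measure_display) (Omega : measurableType d) (R : realType)
  (P : probability Omega R) (X : Omega -> R) (M : R)
  (mX : measurable_fun setT X) (XM : {ae P, forall w, `|X w| <= M}).
Notation mu := (@lebesgue_measure R).

(* VaR on ]0, 1], extended by constants so as to be monotone on all of R *)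
Definition quantile (b : R) : R :=
  if b <= 0 then - M else if b <= 1 then fine (VaR P X b) else M.
Local Notation Q := quantile.

Lemma VaR_quantile (b : R) : 0 < b <= 1 -> VaR P X b = (Q b)%:E.
Proof.
move=> /andP[b0 b1]; rewrite /quantile leNgt b0/= b1.
have := VaR_leM mX XM b1; have := VaR_geNM mX XM b0.
by case: (VaR P X b).
Qed.

Lemma quantile_bounds (b : R) : - M <= Q b <= M.
Proof.
have NMM : - M <= M.
  rewrite -lee_fin (le_trans (VaR_geNM mX XM ltr01))//.
  exact: (VaR_leM mX XM).
have [b0|b0] := leP b 0; first by rewrite /quantile b0 lexx.
have [b1|b1] := leP b 1; last first.
  by rewrite /quantile (leNgt b) b0/= (leNgt b) b1/= NMM lexx.
rewrite -!lee_fin -VaR_quantile; last first.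
  by apply/andP; split.
by rewrite (VaR_geNM mX XM)//= (VaR_leM mX XM).
Qed.

Lemma quantile_homo : {homo Q : b c / b <= c}.
Proof.
move=> b c bc; have /andP[QbN QbM] := quantile_bounds b.
have /andP[QcN QcM] := quantile_bounds c.
have [b0|b0] := leP b 0; first by rewrite /quantile b0.
have [c1|c1] := leP c 1; last first.
  by rewrite /quantile (leNgt c 1) c1/= (leNgt c 0) (lt_trans ltr01 c1).
by rewrite -lee_fin -!VaR_quantile ?VaR_homo// ?b0 ?(le_trans bc)// (lt_le_trans b0 bc).
Qed.

(** The Galois connection [VaR_le_cdf] in real terms; it identifies the law of [Q] under the uniform
    measure with that of [X]. *)
Lemma quantile_le_cdf (b y : R) : 0 < b <= 1 ->
  (Q b <= y) = (b <= fine (P [set w | X w <= y])).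
Proof.
move=> b01; rewrite -lee_fin -VaR_quantile// -[RHS]lee_fin.
by rewrite cdf_fin//; apply/idP/idP => /VaR_le_cdf; apply.
Qed.

Lemma measurable_quantile (D : set R) : measurable D -> measurable_fun D Q.
Proof. by move=> mD; apply: nondecreasing_measurable => // *; exact: quantile_homo. Qed.

Lemma bounded_integrable01 (f : R -> R) (C : R) (D : set R) :
  measurable_fun setT f -> (forall x, `|f x| <= C) ->
  measurable D -> D `<=` `[0, 1] -> mu.-integrable D (EFin \o f).
Proof.
move=> mf fC mD D01.
refine (@integrableS _ _ _ mu `[0, 1]%classic D (EFin \o f) _ mD D01 _) => //.
refine (@measurable_bounded_integrable _ _ _ mu f `[0, 1]%classic _ _ _ _) => //.
- by rewrite /= lebesgue_measure_itv/= lte_fin ltr01 -EFinB ltry.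
- exact: measurable_funTS.
- by exists C; split; [exact: num_real|move=> c Cc x _ /=; apply: (le_trans (fC x)); exact: ltW].
Qed.

Lemma integrable_quantile (D : set R) : measurable D -> D `<=` `[0, 1] ->
  mu.-integrable D (EFin \o Q).
Proof.
apply: (@bounded_integrable01 _ M); first exact: measurable_quantile.
by move=> x; rewrite ler_norml quantile_bounds.
Qed.

Lemma integrable_quantile_pos (a : R) (D : set R) : measurable D -> D `<=` `[0, 1] ->
  mu.-integrable D (EFin \o (fun b => Num.max (Q b - a) 0)).
Proof.
apply: (@bounded_integrable01 _ (M + `|a|)).
  by apply: measurable_maxr => //; apply: measurable_funB => //; exact: measurable_quantile.
move=> x; rewrite ger0_norm; last by rewrite le_max lexx orbT.
have /andP[? ?] := quantile_bounds x; have := ler_norm (- a); rewrite normrN => ?.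
by rewrite ge_max; apply/andP; split; [lra|have := normr_ge0 a; lra].
Qed.

Lemma ES_quantile (al : R) : 0 <= al < 1 ->
  ES P X al = ((1 - al)^-1 * \int[mu]_(b in `[al, 1]) Q b)%:E.
Proof.
move=> /andP[al0 al1]; rewrite /ES al1 EFinM; congr (_ * _)%E.
(* The left endpoint is left out because [VaR P X 0] is [-oo], unlike [Q 0]; dropping one point
   changes neither integral. *)
have VQ b : b \in (`]al, 1]%classic : set R) -> VaR P X b = (Q b)%:E.
  rewrite inE/= in_itv/= => /andP[alb b1]; apply: VaR_quantile.
  by rewrite b1 (le_lt_trans al0 alb).
rewrite /Rintegral fineK; last first.
  apply: integrable_fin_num => //; apply: integrable_quantile => //.
  by apply: subset_itvr; rewrite bnd_simp.
rewrite -[LHS]integral_itv_obnd_cbnd; last first.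
  apply: (eq_measurable_fun (EFin \o Q)); first by move=> b bI; rewrite VQ.
  by apply/measurable_EFinP; apply: measurable_quantile.
rewrite -[RHS]integral_itv_obnd_cbnd; last first.
  by apply/measurable_EFinP; apply: measurable_quantile.
by apply: eq_integral => b; exact: VQ.
Qed.

(* Both sides have the same survival function, by [quantile_le_cdf]. *)
Lemma Epos_quantile (a : R) :
  Epos P X a = (\int[mu]_(b in `[0, 1]) Num.max (Q b - a) 0)%:E.
Proof.
have mY : measurable_fun setT (fun w => Num.max (X w - a) 0).
  by apply: measurable_maxr => //; apply: measurable_funB.
have mZ : measurable_fun setT (fun b => Num.max (Q b - a) 0).
  by apply: measurable_maxr => //; apply: measurable_funB => //; exact: measurable_quantile.
pose Y : {mfun Omega >-> R} := HB.pack (fun w => Num.max (X w - a) 0)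
  (@isMeasurableFun.Build _ _ _ _ _ mY).
pose Z : {mfun measurableTypeR R >-> R} := HB.pack (fun b => Num.max (Q b - a) 0)
  (@isMeasurableFun.Build _ _ (measurableTypeR R) _ _ mZ).
(* With the uniform law on the line, the right side too becomes the expectation of a nonnegative
   random variable, and the layer-cake formula applies to both. *)
pose U := uniform_prob (@ltr01 R).
transitivity ('E_P[(Y : {RV P >-> R})])%E; first by rewrite expectation_def.
transitivity ('E_U[(Z : {RV U >-> R})])%E; last first.
  rewrite expectation_def integral_uniform//; last 2 first.
  - exact/measurable_EFinP.
  - by move=> b; rewrite lee_fin le_max lexx orbT.
  rewrite subr0 invr1 mul1e /Rintegral fineK//.
  by apply: integrable_fin_num => //; apply: integrable_quantile_pos.
rewrite !ge0_expectation_ccdf; last 2 first.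
- by move=> b; rewrite le_max lexx orbT.
- by move=> b; rewrite le_max lexx orbT.
apply: eq_integral => r; rewrite inE/= in_itv/= andbT => r0.
transitivity (1 - P [set w | X w <= a + r]%R)%E.
  rewrite -probability_setC; last exact: measurable_le_cst.
  rewrite /ccdf /distribution /pushforward; congr (P _); apply/seteqP; split => w /=.
    rewrite in_itv/= andbT lt_max (ltNge r 0) r0 orbF => h; apply/negP.
    by rewrite -ltNge; lra.
  move/negP; rewrite -ltNge in_itv/= andbT lt_max => h.
  by apply/orP; left; lra.
rewrite /ccdf /distribution /pushforward.
have -> : Z @^-1` `]r, +oo[ = [set b | a + r < Q b].
  apply/seteqP; split => b /=; rewrite in_itv/= andbT lt_max.
    by rewrite (ltNge r 0) r0 orbF => h; lra.
  by move=> h; apply/orP; left; lra.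
rewrite -(cdf_fin P mX).
set s := a + r; set Fs := fine _.
have Fs01 : 0 <= Fs <= 1 by exact: cdf_bounds.
rewrite /U /uniform_prob /=.
(* Since [Q 0 = - M], the level set within [[0, 1]] contains the point 0 exactly when [s < - M];
   otherwise it is []Fs, 1]]. *)
have [sM|Ms] := ltP s (- M).
  rewrite integral_uniform_pdf1//; last first.
    by move=> b _ /=; have /andP[+ _] := quantile_bounds b; exact: lt_le_trans.
  by rewrite /Fs (cdf_lt_bound_eq0 mX XM sM)// sube0.
rewrite integral_uniform_pdf.
have -> : [set b | s < Q b] `&` `[0, 1] = `]Fs, 1]%classic.
  apply/seteqP; split => b /=; rewrite !in_itv/=.
    move=> [sQ /andP[b0 b1]]; rewrite b1 andbT.
    have [b00|b00] := leP b 0; first by move: sQ; rewrite /quantile b00; lra.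
    by rewrite ltNge -quantile_le_cdf ?b00// -ltNge.
  move=> /andP[Fb b1]; have b0 : 0 < b by lra.
  by rewrite b1 (ltW b0) ltNge quantile_le_cdf ?b0// -ltNge.
rewrite (eq_integral (fun=> 1%E)); last first.
  move=> b; rewrite inE/= in_itv/= /uniform_pdf => /andP[Fb b1].
  by rewrite b1 (_ : 0 <= b) ?subr0 ?invr1//; lra.
rewrite integral_cst//= mul1e lebesgue_measure_itv/= lte_fin.
have [_|F1] := ltP Fs 1; first by rewrite -EFinB.
by rewrite (_ : Fs = 1) ?subee//; lra.
Qed.

End QuantileIntegral.

(** * The Rockafellar-Uryasev inequality, monotonicity and left-continuity of [es] *)

Section RockafellarUryasev.
Set Implicit Arguments.
Unset Strict Implicit.
Context (d : measure_display) (Omega : measurableType d) (R : realType)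
  (P : probability Omega R) (X : Omega -> R) (M : R)
  (mX : measurable_fun setT X) (XM : {ae P, forall w, `|X w| <= M}).
Notation mu := (@lebesgue_measure R).
Local Notation Q := (quantile P X M).
Local Notation tailint al := (\int[mu]_(b in `[al, 1]) Q b).
Local Notation epos a := (\int[mu]_(b in `[0, 1]) Num.max (Q b - a) 0).

Lemma itv01_sub (b0 b1 : bool) (al be : R) : 0 <= al -> be <= 1 ->
  [set` Interval (BSide b0 al) (BSide b1 be)] `<=` (`[0, 1] : set R).
Proof.
move=> al0 be1 x /=; rewrite !itv_boundlr => /andP[h1 h2].
rewrite !bnd_simp; apply/andP; split.
  by apply: (le_trans al0); case: b0 h1; rewrite bnd_simp// => /ltW.
by apply: le_trans be1; case: b1 h2; rewrite bnd_simp// => /ltW.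
Qed.

Lemma Rintegral_itv_cst (b0 b1 : bool) (al be c : R) : al <= be ->
  \int[mu]_(_ in [set` Interval (BSide b0 al) (BSide b1 be)]) c = c * (be - al).
Proof.
move=> ab; rewrite Rintegral_cst//= lebesgue_measure_itv/= lte_fin.
have [_|?] := ltP al be; first by rewrite -EFinB.
by rewrite (_ : be = al) ?subrr//; apply/eqP; rewrite eq_le ab andbT.
Qed.

Lemma integrable_cst01 (c : R) (D : set R) : measurable D -> D `<=` `[0, 1] ->
  mu.-integrable D (EFin \o cst c).
Proof. exact: (@bounded_integrable01 _ _ `|c|). Qed.

Lemma le_quantile_int (b1 : bool) (al be c : R) : 0 <= al <= be -> be <= 1 ->
  (forall b, al <= b <= be -> c <= Q b) ->
  c * (be - al) <= \int[mu]_(b in [set` Interval (BLeft al) (BSide b1 be)]) Q b.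
Proof.
move=> /andP[al0 albe] be1 cQ; rewrite -(@Rintegral_itv_cst true b1)//.
apply: le_Rintegral => //.
- by apply: integrable_cst01 => //; exact: itv01_sub.
- by apply: (integrable_quantile mX XM) => //; exact: itv01_sub.
- move=> x /=; rewrite itv_boundlr bnd_simp => /andP[h1 h2]; apply: cQ.
  by rewrite h1/=; case: b1 h2; rewrite bnd_simp// => /ltW.
Qed.

Lemma ge_quantile_int (b1 : bool) (al be c : R) : 0 <= al <= be -> be <= 1 ->
  (forall b, al <= b <= be -> Q b <= c) ->
  \int[mu]_(b in [set` Interval (BLeft al) (BSide b1 be)]) Q b <= c * (be - al).
Proof.
move=> /andP[al0 albe] be1 cQ; rewrite -(@Rintegral_itv_cst true b1)//.
apply: le_Rintegral => //.
- by apply: (integrable_quantile mX XM) => //; exact: itv01_sub.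
- by apply: integrable_cst01 => //; exact: itv01_sub.
- move=> x /=; rewrite itv_boundlr bnd_simp => /andP[h1 h2]; apply: cQ.
  by rewrite h1/=; case: b1 h2; rewrite bnd_simp// => /ltW.
Qed.

Lemma Rintegral_split (f : R -> R) (al be ga : R) : al <= be <= ga ->
  mu.-integrable `[al, ga] (EFin \o f) ->
  \int[mu]_(b in `[al, ga]) f b =
  \int[mu]_(b in `[al, be[) f b + \int[mu]_(b in `[be, ga]) f b.
Proof.
move=> /andP[albe bega] fi.
have E : `[al, ga]%classic = `[al, be[%classic `|` `[be, ga]%classic.
  by apply: itv_bndbnd_setU; rewrite bnd_simp.
rewrite [in LHS]E; apply: Rintegral_setU => //; first by rewrite -E.
apply/disj_setPS => y [/=]; rewrite 2!in_itv/= => /andP[_ yx] /andP[].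
by rewrite leNgt yx.
Qed.

(** The part of the integral over [[be, al[] is at least [- M * (al - be)]. This modulus of
    continuity serves the left-continuity of [es]. *)
Lemma tailint_le (al be : R) : 0 <= be <= al -> al <= 1 ->
  tailint al <= tailint be + M * (al - be).
Proof.
move=> /andP[be0 beal] al1.
rewrite (@Rintegral_split _ be al 1) ?beal ?al1//; last first.
  by apply: (integrable_quantile mX XM) => //; exact: itv01_sub.
have : - M * (al - be) <= \int[mu]_(b in `[be, al[) Q b.
  apply: le_quantile_int; rewrite ?be0 ?beal// => b _.
  by have /andP[] := quantile_bounds mX XM b.
by lra.
Qed.

(** Integrate [Q b <= a + (Q b - a)_+] over [[al, 1]], then enlarge the range of the nonnegative
    part to [[0, 1]]. *)
Lemma tailint_epos (a al : R) : 0 <= al <= 1 ->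
  tailint al <= a * (1 - al) + epos a.
Proof.
move=> /andP[al0 al1].
have i1 : mu.-integrable `[al, 1] (EFin \o (fun b => Num.max (Q b - a) 0)).
  by apply: (integrable_quantile_pos mX XM) => //; exact: itv01_sub.
have i2 : mu.-integrable `[al, 1] (EFin \o Q).
  by apply: (integrable_quantile mX XM) => //; exact: itv01_sub.
have i3 : mu.-integrable `[al, 1] (EFin \o cst a).
  by apply: integrable_cst01 => //; exact: itv01_sub.
rewrite (@Rintegral_split _ 0 al 1) ?al0 ?al1//; last first.
  exact: (integrable_quantile_pos mX XM).
have h0 : 0 <= \int[mu]_(b in `[0, al[) Num.max (Q b - a) 0.
  by apply: Rintegral_ge0 => b _; rewrite le_max lexx orbT.
have : \int[mu]_(b in `[al, 1]) Q b <=
       \int[mu]_(b in `[al, 1]) (a + Num.max (Q b - a) 0).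
  apply: le_Rintegral => //; first exact: (integrableD _ i3 i1).
  by move=> b _; rewrite -lerBlDl le_max lexx.
rewrite RintegralD// Rintegral_itv_cst// => /le_trans; apply.
by rewrite lerD2l lerDr.
Qed.

(** Both inequalities behind [tailint_epos] become equalities: [(Q b - a)_+] vanishes below [al] and
    equals [Q b - a] above. The null points 0 and [al] are left free, so that [a] may be any point
    between the lower and the upper quantile. *)
Lemma tailint_epos_eq (a al : R) : 0 <= al <= 1 ->
  (forall b, 0 < b < al -> Q b <= a) -> (forall b, al < b <= 1 -> a <= Q b) ->
  tailint al = a * (1 - al) + epos a.
Proof.
move=> /andP[al0 al1] Qa aQ.
have i1 : mu.-integrable `[al, 1] (EFin \o (fun b => Num.max (Q b - a) 0)).
  by apply: (integrable_quantile_pos mX XM) => //; exact: itv01_sub.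
have i3 : mu.-integrable `[al, 1] (EFin \o cst a).
  by apply: integrable_cst01 => //; exact: itv01_sub.
rewrite (@Rintegral_split (fun b => Num.max (Q b - a) 0) 0 al 1) ?al0 ?al1//; last first.
  exact: (integrable_quantile_pos mX XM).
have -> : \int[mu]_(b in `[0, al[) Num.max (Q b - a) 0 = 0.
  rewrite -Rintegral_itv_obnd_cbnd; last first.
    by apply: (integrable_quantile_pos mX XM) => //; exact: itv01_sub.
  rewrite (@eq_Rintegral _ _ _ _ _ (cst 0)).
    by rewrite Rintegral_cst// mul0r.
  move=> b; rewrite inE/= in_itv/= => /Qa ?; apply/max_idPr; lra.
rewrite add0r -(@Rintegral_itv_cst true false)// -RintegralD//.
rewrite -Rintegral_itv_obnd_cbnd; last first.
  by apply: (integrable_quantile mX XM) => //; exact: itv01_sub.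
rewrite -[RHS]Rintegral_itv_obnd_cbnd; last first.
  apply: (@integrableS _ _ _ mu `[al, 1]%classic) => //.
    by apply: subset_itvr; rewrite bnd_simp.
  exact: (integrableD _ i3 i1).
apply: eq_Rintegral => b; rewrite inE/= in_itv/= => /aQ ?.
by rewrite (max_idPl _) ?subr_ge0// addrC subrK.
Qed.

Definition es (al : R) : R := if al < 1 then (1 - al)^-1 * tailint al else Q 1.

Lemma ES_es (al : R) : 0 <= al <= 1 -> ES P X al = (es al)%:E.
Proof.
move=> /andP[al0 al1]; rewrite /es; have [al1'|al1'] := ltP al 1.
  by rewrite (ES_quantile mX XM)// al0.
by rewrite /ES ltNge al1'/= (VaR_quantile mX XM)// ltr01 lexx.
Qed.

Lemma es_tailint (al : R) : al < 1 -> (1 - al) * es al = tailint al.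
Proof.
by move=> al1; rewrite /es al1 mulrA divff ?mul1r//; lra.
Qed.

Lemma es_leP (al c : R) : al < 1 -> (es al <= c) = (tailint al <= c * (1 - al)).
Proof.
by move=> al1; rewrite -es_tailint// [in RHS]mulrC ler_pM2r// subr_gt0.
Qed.

Lemma quantile_le_es (al : R) : 0 <= al <= 1 -> Q al <= es al.
Proof.
move=> /andP[al0 al1]; have [al1'|al1'] := ltP al 1; last first.
  by rewrite /es ltNge al1'/=; apply: (quantile_homo mX XM).
have : Q al * (1 - al) <= tailint al.
  apply: le_quantile_int; rewrite ?al0// => b /andP[? _].
  exact: (quantile_homo mX XM).
by rewrite -es_tailint// mulrC ler_pM2l// subr_gt0.
Qed.

Lemma es_le_quantile1 (al : R) : 0 <= al <= 1 -> es al <= Q 1.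
Proof.
move=> /andP[al0 al1]; have [al1'|al1'] := ltP al 1; last first.
  by rewrite /es ltNge al1'.
rewrite es_leP//; apply: ge_quantile_int; rewrite ?al0// => b /andP[_ ?].
exact: (quantile_homo mX XM).
Qed.

Lemma es_bounds (al : R) : 0 <= al <= 1 -> - M <= es al <= M.
Proof.
move=> al01; have /andP[? _] := quantile_bounds mX XM al.
have /andP[_ ?] := quantile_bounds mX XM 1.
have := quantile_le_es al01; have := es_le_quantile1 al01; lra.
Qed.

(** The bound at level [al] is tested at [a = Q be], which is optimal at level [be]. It exceeds
    [es be * (1 - al)] by [- (es be - Q be) * (be - al)], which is at most 0. *)
Lemma es_homo (al be : R) : 0 <= al <= be -> be <= 1 -> es al <= es be.
Proof.
move=> /andP[al0 albe] be1; have [be1'|be1'] := ltP be 1; last first.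
  by rewrite {2}/es ltNge be1'/=; apply: es_le_quantile1; rewrite al0 (le_trans albe).
have e0 : 0 <= epos (Q be) by apply: Rintegral_ge0 => b _; rewrite le_max lexx orbT.
have al1 : al < 1 by apply: le_lt_trans be1'.
have Ial : tailint al <= Q be * (1 - al) + epos (Q be).
  by apply: tailint_epos; rewrite al0 ltW.
have Ibe : tailint be = Q be * (1 - be) + epos (Q be).
  apply: tailint_epos_eq; rewrite ?(le_trans al0)// => b /andP[? ?];
    by apply: (quantile_homo mX XM); exact: ltW.
move: (epos (Q be)) e0 Ial Ibe => E e0 Ial Ibe.
have Qes : Q be <= es be by apply: quantile_le_es; rewrite (le_trans al0).
have := es_tailint be1'; rewrite es_leP// Ibe => Ees.
have := mulr_ge0 (_ : 0 <= es be - Q be) (_ : 0 <= be - al).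
rewrite !subr_ge0 => /(_ Qes albe); lra.
Qed.

(* Left-continuity of [es]; at [al = 1] it comes from [Q al <= es al]. *)
Lemma es_le_left (al c : R) : 0 <= al <= 1 ->
  (forall e, 0 < e -> exists be, [/\ 0 <= be, al - e < be, be <= al & es be <= c]) ->
  es al <= c.
Proof.
move=> /andP[al0 al1] H; have [al1'|al1'] := ltP al 1; last first.
  have {al1' al1}al1 : al = 1 by apply/le_anti/andP.
  rewrite /es al1 ltxx (quantile_le_cdf mX XM) ?ltr01 ?lexx//.
  apply/ler_addgt0Pr => e e0.
  (* The cap at 1 forces [be > 0], as [quantile_le_cdf] requires. *)
  have [|be [be0 ebe be1 esc]] := H (Num.min e 1); first by rewrite lt_min e0 ltr01.
  have be_gt0 : 0 < be.
    by apply: le_lt_trans ebe; rewrite al1 subr_ge0 ge_min lexx orbT.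
  rewrite al1 in be1.
  have : Q be <= c by apply: le_trans esc; apply: quantile_le_es; rewrite be0.
  rewrite (quantile_le_cdf mX XM) ?be_gt0//.
  have : Num.min e 1 <= e by rewrite ge_min lexx.
  by rewrite al1 in ebe; lra.
rewrite es_leP//; apply/ler_addgt0Pr => e e0.
(* Moving from [be] to [al] costs at most [M * (al - be)] in the tail integral and [c * (al - be)]
   on the other side, so a distance [e / k] costs at most [e]. *)
pose k := `|M| + `|c| + 1.
have k0 : 0 < k by rewrite /k ltr_wpDl// addr_ge0.
have [|be [be0 ebe bal esc]] := H (e / k); first exact: divr_gt0.
have be1 : be < 1 by apply: le_lt_trans al1'.
move: esc; rewrite es_leP// => Ibe.
have := @tailint_le al be; rewrite be0 bal => /(_ isT al1) Ial.
have kd : k * (al - be) <= e.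
  rewrite mulrC -ler_pdivlMr//; lra.
have d0 : 0 <= al - be by lra.
have := ler_wpM2r d0 (ler_norm M); have := ler_wpM2r d0 (ler_norm c).
rewrite /k in kd; lra.
Qed.

(** For [al < 1] this is [tailint_epos] divided by [1 - al]. At [al = 1] the right side is finite
    only if the expected excess is 0; then [es] is at most [a] at every level below 1, and
    left-continuity carries this to 1. *)
Lemma es_RU (a al : R) : 0 <= al <= 1 ->
  ((es al)%:E <= a%:E + divE (Epos P X a) (1 - al))%E.
Proof.
move=> /andP[al0 al1]; rewrite (Epos_quantile mX XM) /divE.
case: eqP => /= [al1'|al1'].
  case: eqP => [[ea]|_]; last by rewrite addey ?leey.
  rewrite adde0 lee_fin; apply: es_le_left; rewrite ?al0// => e ee0.
  exists (Num.max 0 (al - e / 2)); split.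
  - by rewrite le_max lexx.
  - by rewrite lt_max; apply/orP; right; lra.
  - by rewrite ge_max al0; lra.
  - have b1 : Num.max 0 (al - e / 2) < 1 by rewrite gt_max ltr01/=; lra.
    rewrite es_leP//; have := @tailint_epos a (Num.max 0 (al - e / 2)).
    by rewrite ea addr0; apply; rewrite le_max lexx/= ltW.
have al1'' : al < 1 by rewrite lt_neqAle al1 andbT; apply/eqP => h; apply: al1'; rewrite h subrr.
rewrite -EFinM -EFinD lee_fin es_leP// mulrDl mulfVK ?subr_eq0; last by apply/eqP; lra.
by apply: tailint_epos; rewrite al0.
Qed.

Lemma es_RU_eq (a al : R) : 0 <= al < 1 ->
  (VaR P X al <= a%:E <= VaRp P X al)%E ->
  (a%:E + divE (Epos P X a) (1 - al))%E = (es al)%:E.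
Proof.
move=> /andP[al0 al1] /andP[Va aV]; rewrite (Epos_quantile mX XM) /divE.
have al1' : 1 - al != 0 by rewrite subr_eq0; apply/eqP; lra.
rewrite al1' -EFinM -EFinD; congr EFin; apply: (mulfI al1').
rewrite es_tailint// mulrDr mulrCA divff// mulr1 mulrC; apply/esym.
apply: tailint_epos_eq; first by rewrite al0 ltW.
- move=> b /andP[b0 bal]; rewrite -lee_fin -(VaR_quantile mX XM); last first.
    by rewrite b0 ltW// (lt_trans bal).
  by apply: le_trans Va; apply: VaR_homo; exact: ltW.
- move=> b /andP[bal b1]; rewrite -lee_fin -(VaR_quantile mX XM); last first.
    by rewrite b1 andbT (le_lt_trans al0).
  apply: (le_trans aV); apply: ereal_inf_le_tmp => _ [y /= yb <-]; exists y => //=.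
  by apply: lt_le_trans yb; rewrite lte_fin.
Qed.

(** [Q] never exceeds [Q 1] on [[0, 1]], so the excess is 0 and the convention 0/0 = 0 applies. *)
Lemma es_RU_eq1 : ((Q 1)%:E + divE (Epos P X (Q 1)) 0)%E = (es 1)%:E.
Proof.
rewrite (Epos_quantile mX XM) /divE eqxx/=.
have -> : epos (Q 1) = 0.
  rewrite (@eq_Rintegral _ _ _ _ _ (cst 0)); first by rewrite Rintegral_itv_cst// mul0r.
  move=> b; rewrite inE/= in_itv/= => /andP[_ b1]; apply/max_idPr.
  by rewrite subr_le0; exact: (quantile_homo mX XM).
by rewrite eqxx adde0 /es ltxx.
Qed.

End RockafellarUryasev.

(** * The crossing point [xs] and the minimum of [TL] *)

Section Representation.
Set Implicit Arguments.
Unset Strict Implicit.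
Context (d : measure_display) (Omega : measurableType d) (R : realType)
  (P : probability Omega R) (X : Omega -> R) (M : R)
  (mX : measurable_fun setT X) (XM : {ae P, forall w, `|X w| <= M}).
Context (Lam : R -> R) (Lam01 : forall x, 0 <= Lam x <= 1)
  (Lamdec : forall x y, x <= y -> Lam y <= Lam x)
  (Lamrc : forall x, Lam @ x^'+ --> Lam x).
Local Notation Q := (quantile P X M).
Local Notation G x := (es P X M (Lam x)).

(** Provides a real point in the interval of minimisers. At level 0, where [VaR] is [-oo], this
    point is [- M], below which the distribution function vanishes. *)
Lemma VaR_quantile_VaRp (al : R) : 0 <= al <= 1 ->
  (VaR P X al <= (Q al)%:E <= VaRp P X al)%E.
Proof.
move=> /andP[al0 al1]; apply/andP; split.
  have [al_le0|al_gt0] := leP al 0; last by rewrite (VaR_quantile mX XM)// al_gt0.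
  apply: ereal_inf_lbound; exists (Q al) => //=.
  by apply: (@le_trans _ _ 0%E) => //; rewrite lee_fin.
apply: le_ereal_inf_tmp => _ [y /= yal <-]; rewrite lee_fin.
have [al_le0|al_gt0] := leP al 0.
  rewrite /quantile al_le0 leNgt; apply/negP => /(cdf_lt_bound_eq0 mX XM) y0.
  by move: yal; rewrite y0 lte_fin ltNge al0.
rewrite (quantile_le_cdf mX XM) ?al_gt0//.
by rewrite -lee_fin (cdf_fin P mX) ltW.
Qed.

Lemma ESL_fin : ESL P Lam X = (fine (ESL P Lam X))%:E.
Proof.
have E x : Order.min (ES P X (Lam x)) x%:E = (Num.min (G x) x)%:E.
  by rewrite (ES_es mX XM)// -EFin_min.
have lo : ((- M)%:E <= ESL P Lam X)%E.
  apply: le_ereal_sup_tmp; exists (Num.min (G (- M)) (- M))%:E.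
    by exists (- M) => //; rewrite E.
  by rewrite lee_fin le_min lexx andbT; have /andP[] := es_bounds mX XM (Lam01 (- M)).
have hi : (ESL P Lam X <= M%:E)%E.
  apply: ge_ereal_sup => _ [x _ <-]; rewrite E lee_fin ge_min.
  by have /andP[_ ->] := es_bounds mX XM (Lam01 x).
by move: lo hi; case: (ESL P Lam X).
Qed.

Local Notation xs := (fine (ESL P Lam X)).

Lemma min_es_le_ESL (x : R) : Num.min (G x) x <= xs.
Proof.
rewrite -lee_fin -ESL_fin; apply: ereal_sup_ubound; exists x => //.
by rewrite (ES_es mX XM)// -EFin_min.
Qed.

Lemma lt_ESL (y : R) : y < xs -> exists x, y < Num.min (G x) x.
Proof.
rewrite -lte_fin -ESL_fin => /ereal_sup_gt[_ [x _ <-]].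
by rewrite (ES_es mX XM)// -EFin_min lte_fin; exists x.
Qed.

(** For [x > xs] the bound [min (G x) x <= xs] forces [G x <= xs]. As [x] decreases to [xs],
    right-continuity brings [Lam x] up to [Lam xs], and left-continuity of [es] passes to the
    limit. *)
Lemma es_ESL : G xs <= xs.
Proof.
apply: (es_le_left mX XM) => // e e0.
have /cvgrPdist_lt/(_ e e0) H := @Lamrc xs.
have [x [/= xe xsx]] :
    ([set x | `|Lam xs - Lam x| < e] `&` [set x | xs < x]) !=set0.
  by apply: (@filter_ex _ xs^'+); apply: filterI => //; exact: nbhs_right_gt.
exists (Lam x); split.
- by have /andP[] := Lam01 x.
- by rewrite ltrBlDr -ltrBlDl; apply: le_lt_trans xe; exact: ler_norm.
- by apply: Lamdec; exact: ltW.
- by have := min_es_le_ESL x; rewrite ge_min => /orP[//|]; rewrite leNgt xsx.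
Qed.

Lemma ESL_le_es (x : R) : x < xs -> xs <= G x.
Proof.
move=> xxs; rewrite leNgt; apply/negP => Gxs.
(* Such a [y] lies to the right of [x] and has [G y > G x], against the monotonicity of [G]. *)
have /lt_ESL[y] : Num.max (G x) x < xs by rewrite gt_max Gxs.
rewrite lt_min !gt_max => /andP[/andP[Gxy _] /andP[_ xy]].
have /andP[? ?] := Lam01 x; have /andP[? ?] := Lam01 y.
have := @es_homo _ _ _ _ _ _ mX XM (Lam y) (Lam x).
by rewrite Lamdec ?(ltW xy)//; lra.
Qed.

Lemma ESL_TL (a x : R) : (ESL P Lam X <= TL P Lam a x X)%E.
Proof.
rewrite ESL_fin /TL le_max; have [xsx|xxs] := leP xs x.
  by rewrite [(xs%:E <= x%:E)%E]lee_fin xsx orbT.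
by apply/orP; left; apply: le_trans (es_RU mX XM _ (Lam01 x)); rewrite lee_fin ESL_le_es.
Qed.

Lemma TL_ESL (a : R) : (a%:E + divE (Epos P X a) (1 - Lam xs))%E = (G xs)%:E ->
  TL P Lam a xs X = ESL P Lam X.
Proof.
move=> H; rewrite /TL H ESL_fin -EFin_max; congr EFin.
by apply/max_idPr; exact: es_ESL.
Qed.

Lemma TL_ESL_lt1 (a : R) : Lam xs < 1 ->
  (VaR P X (Lam xs) <= a%:E <= VaRp P X (Lam xs))%E -> TL P Lam a xs X = ESL P Lam X.
Proof.
move=> L1 aV; apply: TL_ESL; apply: (es_RU_eq mX XM) => //.
by have /andP[->] := Lam01 xs.
Qed.

Lemma TL_ESL_1 (a : R) : Lam xs = 1 -> a%:E = VaR P X 1 -> TL P Lam a xs X = ESL P Lam X.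
Proof.
move=> L1; rewrite (VaR_quantile mX XM) ?ltr01 ?lexx// => -[->].
by apply: TL_ESL; rewrite L1 subrr; exact: (es_RU_eq1 mX XM).
Qed.

Lemma TL_ESL_exists : exists a x : R, TL P Lam a x X = ESL P Lam X.
Proof.
have [L1|L1] := ltP (Lam xs) 1.
  exists (Q (Lam xs)), xs; apply: TL_ESL_lt1 => //; exact: VaR_quantile_VaRp.
exists (Q 1), xs; apply: TL_ESL_1.
  by apply/le_anti; rewrite L1 andbT; have /andP[] := Lam01 xs.
by rewrite (VaR_quantile mX XM)// ltr01 lexx.
Qed.

End Representation.

(** * Convex combinations in the extended reals *)

Section ExtendedConvexCombination.
Set Implicit Arguments.
Unset Strict Implicit.
Context (R : realType).
Implicit Types (t r : R) (A B : \bar R).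

Lemma lee_conv t A1 A2 r1 r2 : 0 < t < 1 -> (A1 <= r1%:E)%E -> (A2 <= r2%:E)%E ->
  (t%:E * A1 + (1 - t)%:E * A2 <= (t * r1 + (1 - t) * r2)%R%:E)%E.
Proof.
move=> /andP[t0 t1] h1 h2; rewrite [leRHS]EFinD !EFinM.
by apply: leeD; apply: lee_wpmul2l => //; rewrite lee_fin; lra.
Qed.

(** Reduces a convexity inequality to real upper bounds of the two values, so that it can be checked
    on sublevel sets; an infinite value makes the right side [+oo]. *)
Lemma conv_lee t B A1 A2 : 0 < t < 1 -> (-oo < A1)%E -> (-oo < A2)%E ->
  (forall r1 r2, (A1 <= r1%:E)%E -> (A2 <= r2%:E)%E ->
    (B <= (t * r1 + (1 - t) * r2)%R%:E)%E) ->
  (B <= t%:E * A1 + (1 - t)%:E * A2)%E.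
Proof.
move=> /andP[t0 t1]; have t1' : 0 < 1 - t by lra.
case: A1 => [r1| |] // _; case: A2 => [r2| |] // _ H.
- by apply: le_trans (H r1 r2 _ _) _.
- by rewrite gt0_muley ?lte_fin// addey ?leey.
- by rewrite gt0_muley ?lte_fin// addye ?leey.
- by rewrite !gt0_muley ?lte_fin// addye ?leey.
Qed.

(** This is how convexity yields quasi-convexity. *)
Lemma conv_le_max t A1 A2 : 0 < t < 1 ->
  (t%:E * A1 + (1 - t)%:E * A2 <= Order.max A1 A2)%E.
Proof.
move=> t01; have [t0 t1] := andP t01.
have : (A1 <= Order.max A1 A2)%E by rewrite le_max lexx.
have : (A2 <= Order.max A1 A2)%E by rewrite le_max lexx orbT.
case: (Order.max A1 A2) => [r| |] h2 h1; [|by rewrite leey|].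
  by apply: le_trans (lee_conv t01 h1 h2) _; rewrite lee_fin; lra.
move: h1 h2; rewrite !leeNy_eq => /eqP -> /eqP ->.
by rewrite !gt0_muleNy ?lte_fin//; lra.
Qed.

End ExtendedConvexCombination.

(** * Finiteness and joint convexity of the expected excess *)

Section Epos.
Set Implicit Arguments.
Unset Strict Implicit.
Context (d : measure_display) (Omega : measurableType d) (R : realType)
  (P : probability Omega R).

Lemma Epos_fin (X : Omega -> R) (a : R) : Linf P X ->
  exists2 e : R, 0 <= e & Epos P X a = e%:E.
Proof.
move=> [mX [M XM]]; rewrite (Epos_quantile mX XM); eexists; last by [].
by apply: Rintegral_ge0 => b _; rewrite le_max lexx orbT.
Qed.

Lemma Epos_conv (X1 X2 : Omega -> R) (a1 a2 t : R) :
  measurable_fun setT X1 -> measurable_fun setT X2 -> 0 < t < 1 ->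
  (Epos P (ccombf t X1 X2) (ccomb t a1 a2)
     <= t%:E * Epos P X1 a1 + (1 - t)%:E * Epos P X2 a2)%E.
Proof.
move=> mX1 mX2 /andP[t0 t1].
have mp (Y : Omega -> R) (a : R) : measurable_fun setT Y ->
    measurable_fun setT (fun w => (Num.max (Y w - a) 0)%:E).
  by move=> mY; apply/measurable_EFinP; apply: measurable_maxr => //; apply: measurable_funB.
have p0 (Y : Omega -> R) (a : R) w : (0 <= (Num.max (Y w - a) 0)%:E)%E.
  by rewrite lee_fin le_max lexx orbT.
have t1' : 0 <= 1 - t by lra.
have tp0 (s : R) (Y : Omega -> R) (a : R) w : 0 <= s ->
    (0 <= s%:E * (Num.max (Y w - a) 0)%:E)%E.
  by move=> s0; apply: mule_ge0 (p0 _ _ _); rewrite lee_fin.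
rewrite /Epos -!ge0_integralZl_EFin//; try (by [exact: ltW | exact: mp]).
rewrite -ge0_integralD//;
  try (by [move=> w _; apply: tp0 => //; exact: ltW
          | apply: emeasurable_funM => //; exact: mp]).
apply: ge0_le_integral => //.
- apply: mp; rewrite /ccombf; apply: measurable_funD; exact: measurable_funM.
- by apply: emeasurable_funD; apply: emeasurable_funM => //; exact: mp.
- move=> w _; rewrite -!EFinM -EFinD lee_fin ge_max /ccombf /ccomb.
  have : 0 <= Num.max (X1 w - a1) 0 by rewrite le_max lexx orbT.
  have : 0 <= Num.max (X2 w - a2) 0 by rewrite le_max lexx orbT.
  have : X1 w - a1 <= Num.max (X1 w - a1) 0 by rewrite le_max lexx.
  have : X2 w - a2 <= Num.max (X2 w - a2) 0 by rewrite le_max lexx.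
  move: (Num.max _ _) (Num.max _ _) => m2 m1 h2 h1 m20 m10.
  apply/andP; split; last by apply: addr_ge0; apply: mulr_ge0 => //; exact: ltW.
  have := ler_wpM2l (ltW t0) h1; have := ler_wpM2l t1' h2; lra.
Qed.

End Epos.

(** * Convexity and quasi-convexity of [TL] *)

Section Convexity.
Set Implicit Arguments.
Unset Strict Implicit.
Context (d : measure_display) (Omega : measurableType d) (R : realType)
  (P : probability Omega R).
Context (Lam : R -> R) (Lam01 : forall x, 0 <= Lam x <= 1).

(* In this form the conventions 0/0 = 0 and c/0 = oo disappear. *)
Lemma TL_le (X : Omega -> R) (a x e r : R) : 0 <= e -> Epos P X a = e%:E ->
  (TL P Lam a x X <= r%:E)%E <-> [/\ x <= r, a <= r & e <= (r - a) * (1 - Lam x)].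
Proof.
move=> e0 Ee; rewrite /TL Ee ge_max lee_fin /divE.
have /andP[L0 L1] := Lam01 x; case: eqP => /= [L1'|/eqP L1'].
  rewrite L1' mulr0; case: eqP => [[->]|ne].
    by rewrite adde0 lee_fin; split=> [/andP[]|[-> ->]].
  rewrite addey// leye_eq/=; split=> // -[_ _ e0']; exfalso; apply: ne.
  by congr EFin; apply/le_anti/andP.
have {L1'}L1' : 0 < 1 - Lam x by rewrite lt_neqAle eq_sym L1' subr_ge0.
rewrite -EFinM -EFinD lee_fin -lerBrDl ler_pdivrMr//; split=> [/andP[era ->]|[-> _ ->]//].
split=> //; rewrite -subr_ge0; apply: contraTT era; rewrite -!ltNge => ra.
by apply: lt_le_trans e0; rewrite nmulr_rlt0.
Qed.

Lemma TL_gtNy (X : Omega -> R) (a x : R) : (-oo < TL P Lam a x X)%E.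
Proof. by apply: (@lt_le_trans _ _ x%:E); rewrite ?ltNyr// /TL le_max lexx orbT. Qed.

(** With one common value of [Lam], the conditions of [TL_le] are linear in [r], [a], [x] and [e],
    and [Epos] is jointly convex. The two equations on [Lam] cover both a fixed [x] and a constant
    [Lam]. *)
Lemma TL_conv (X1 X2 : Omega -> R) (a1 a2 x1 x2 t : R) :
  Linf P X1 -> Linf P X2 -> 0 < t < 1 ->
  Lam x1 = Lam (ccomb t x1 x2) -> Lam x2 = Lam (ccomb t x1 x2) ->
  (TL P Lam (ccomb t a1 a2) (ccomb t x1 x2) (ccombf t X1 X2)
     <= t%:E * TL P Lam a1 x1 X1 + (1 - t)%:E * TL P Lam a2 x2 X2)%E.
Proof.
move=> X1L X2L t01 L1 L2; have /andP[t0 t1] := t01.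
have t1' : 0 <= 1 - t by lra.
apply: conv_lee => //; [exact: TL_gtNy..|move=> r1 r2].
have [e1 e10 E1] := Epos_fin a1 X1L; have [e2 e20 E2] := Epos_fin a2 X2L.
move=> /(TL_le _ _ e10 E1)[xr1 ar1 er1] /(TL_le _ _ e20 E2)[xr2 ar2 er2].
have := @Epos_conv _ _ _ P _ _ a1 a2 _ X1L.1 X2L.1 t01.
have : (0 <= Epos P (ccombf t X1 X2) (ccomb t a1 a2))%E.
  by apply: integral_ge0 => w _; rewrite lee_fin le_max lexx orbT.
rewrite E1 E2 -!EFinM -EFinD.
case E : (Epos _ _ _) => [e| |]// e0; rewrite lee_fin => econv.
apply/(TL_le _ _ _ E); first by rewrite -lee_fin.
move: er1 er2; rewrite L1 L2; move: (Lam _) => L er1 er2; rewrite /ccomb.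
have h1 := ler_wpM2l (ltW t0) xr1; have h2 := ler_wpM2l t1' xr2.
have h3 := ler_wpM2l (ltW t0) ar1; have h4 := ler_wpM2l t1' ar2.
have h5 := ler_wpM2l (ltW t0) er1; have h6 := ler_wpM2l t1' er2.
by split; lra.
Qed.

Lemma Linf_cst (K : R) : Linf P (cst K).
Proof. by split; [exact: measurable_cst|exists `|K|; apply: aeW]. Qed.

Lemma Epos_cst (K a : R) : Epos P (cst K) a = (Num.max (K - a) 0)%:E.
Proof.
transitivity (\int[P]_(w in setT) cst (Num.max (K - a) 0)%:E w)%E => //.
by rewrite integral_cst//= probability_setT mule1.
Qed.

Lemma invOneMinus_le (x r : R) :
  (invOneMinus Lam x <= r%:E)%E <-> 1 <= r * (1 - Lam x).
Proof.
rewrite /invOneMinus; have /andP[L0 L1] := Lam01 x; case: eqP => /= [->|/eqP L1'].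
  by rewrite leye_eq subrr mulr0 ler10.
have L1'' : 0 < 1 - Lam x by rewrite subr_gt0 lt_neqAle L1'.
by rewrite lee_fin -[(_)^-1]mul1r ler_pdivrMr.
Qed.

Lemma invOneMinus_gtNy (x : R) : (-oo < invOneMinus Lam x)%E.
Proof. by rewrite /invOneMinus; case: ifP => _; rewrite ?ltNyr. Qed.

Lemma convex_TL_invOneMinus :
  (forall (a : R) (X : Omega -> R), Linf P X -> convexE (fun x => TL P Lam a x X)) ->
  convexE (invOneMinus Lam).
Proof.
move=> H u v t t01; have /andP[t0 t1] := t01.
apply: conv_lee => //; [exact: invOneMinus_gtNy..|move=> r1 r2].
move=> /invOneMinus_le h1 /invOneMinus_le h2.
(* The constant [K] with [a = K - 1] has expected excess 1, so the level [K - 1 + r] of [TL] encodes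
   [1 <= r * (1 - Lam x)]; as [r >= 1], the choice of [K] keeps [u] and [v] below their levels. *)
pose K := Num.max u v.
have uK : u <= K by rewrite le_max lexx.
have vK : v <= K by rewrite le_max lexx orbT.
have EK : Epos P (cst K) (K - 1) = 1%:E.
  by rewrite Epos_cst opprB addrC subrK; congr EFin; apply/max_idPl.
have ge1 x r : 1 <= r * (1 - Lam x) -> 1 <= r.
  have /andP[L0 L1] := Lam01 x; move=> h; rewrite leNgt; apply/negP => r_lt1.
  have : 0 <= (1 - r) * (1 - Lam x) by apply: mulr_ge0; lra.
  move=> h'; have Lx0 : Lam x = 0 by lra.
  by rewrite Lx0 in h; lra.
have Tle x r : x <= K -> 1 <= r * (1 - Lam x) ->
    (TL P Lam (K - 1) x (cst K) <= (K - 1 + r)%:E)%E.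
  move=> xK h; have ? := ge1 _ _ h.
  by apply/(TL_le _ _ ler01 EK); split; [lra|lra|rewrite addrC addKr].
have := le_trans (H (K - 1) _ (Linf_cst K) u v t t01)
  (lee_conv t01 (Tle _ _ uK h1) (Tle _ _ vK h2)).
move=> /(TL_le _ _ ler01 EK)[_ _ h]; apply/invOneMinus_le.
by apply: le_trans h _; rewrite le_eqVlt; apply/orP; left; apply/eqP; ring.
Qed.

(** For [e > 0] the last condition of [TL_le] says that [invOneMinus Lam x] is at most
    [(r - a) / e], a bound affine in [r]; for [e = 0] it follows from [a <= r]. *)
Lemma convex_invOneMinus_TL : convexE (invOneMinus Lam) ->
  forall (a : R) (X : Omega -> R), Linf P X -> convexE (fun x => TL P Lam a x X).
Proof.
move=> H a X XL u v t t01; have /andP[t0 t1] := t01; have t1' : 0 <= 1 - t by lra.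
apply: conv_lee => //; [exact: TL_gtNy..|move=> r1 r2].
have [e e0 Ee] := Epos_fin a XL.
move=> /(TL_le _ _ e0 Ee)[ur1 ar1 er1] /(TL_le _ _ e0 Ee)[vr2 ar2 er2].
have h1 := ler_wpM2l (ltW t0) ur1; have h2 := ler_wpM2l t1' vr2.
have h3 := ler_wpM2l (ltW t0) ar1; have h4 := ler_wpM2l t1' ar2.
apply/(TL_le _ _ e0 Ee); split; [by rewrite /ccomb; lra|lra|].
have [e_le0|e_gt0] := leP e 0.
  apply: (le_trans e_le0); apply: mulr_ge0; first by lra.
  by rewrite subr_ge0; have /andP[] := Lam01 (ccomb t u v).
have inv x r : e <= (r - a) * (1 - Lam x) -> (invOneMinus Lam x <= ((r - a) / e)%:E)%E.
  by move=> h; apply/invOneMinus_le; rewrite mulrAC ler_pdivlMr// mul1r.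
have := le_trans (H u v t t01) (lee_conv t01 (inv _ _ er1) (inv _ _ er2)).
move=> /invOneMinus_le; rewrite !mulrA -mulrDl mulrAC ler_pdivlMr// mul1r => /le_trans; apply.
by rewrite le_eqVlt; apply/orP; left; apply/eqP; ring.
Qed.

Lemma quasiconvex_TL_cst :
  (forall X : Omega -> R, Linf P X -> forall (a1 a2 x1 x2 t : R), 0 < t < 1 ->
     (TL P Lam (ccomb t a1 a2) (ccomb t x1 x2) X
        <= Order.max (TL P Lam a1 x1 X) (TL P Lam a2 x2 X))%E) ->
  (forall x y, x <= y -> Lam y <= Lam x) ->
  exists c : R, forall x, Lam x = c.
Proof.
move=> H Lamdec; exists (Lam 0).
suff {Lamdec}S x1 x2 : x1 < x2 -> Lam x1 <= Lam x2.
  move=> x; apply/le_anti; have [x0|x0|->] := ltgtP x 0; last by rewrite lexx.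
    by rewrite (S _ _ x0) Lamdec ?ltW.
  by rewrite (S _ _ x0) Lamdec ?ltW.
move=> x12; rewrite leNgt; apply/negP => L21.
have /andP[L20 _] := Lam01 x2; have /andP[_ L11] := Lam01 x1.
set L1 := Lam x1 in L21 L11 *; set L2 := Lam x2 in L21 L20 *.
(* A level strictly above [L2] is used because [L2] may be 0; [u] is then a finite value of
   [(1 - L) / L] above its value at [L1] and below its value at [L2]. *)
pose Lm := (L1 + L2) / 2; have Lm0 : 0 < Lm by rewrite /Lm; lra.
have LmL1 : Lm < L1 by rewrite /Lm; lra.
have L2Lm : L2 < Lm by rewrite /Lm; lra.
pose u := (1 - Lm) / Lm.
have uLm : u * Lm = 1 - Lm by rewrite mulfVK// gt_eqF.
have u0 : 0 < u by apply: divr_gt0 => //; lra.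
have uL1 : 1 - L1 < u * L1 by have := ltr_pM2l u0 Lm L1; rewrite LmL1; lra.
have uL2 : u * L2 <= 1 - L2 by have := ltr_pM2l u0 L2 Lm; rewrite L2Lm; lra.
have uL1_gt0 : 0 < u * L1 by apply: mulr_gt0 => //; lra.
pose q := (1 - L1) / (u * L1).
have qE : q * (u * L1) = 1 - L1 by rewrite mulfVK// gt_eqF.
have q0 : 0 <= q by apply: divr_ge0; lra.
have q1 : q < 1 by rewrite ltr_pdivrMr// mul1r.
(* Any [s] strictly between [q] and 1 makes [s * u] exceed [(1 - L1) / L1]. *)
pose s := (q + 1) / 2.
have s0 : 0 < s by rewrite /s; lra.
have s1 : s < 1 by rewrite /s; lra.
have suL1 : 1 - L1 < s * (u * L1) by rewrite -qE ltr_pM2r// /s; lra.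
(* Chosen so that [x1] divides the segment from [x0] to [x2] with weight [s] on [x2]. Concavity,
   with the values 0 at [x0] and [u] at [x2], would then give at least [s * u] at [x1]. *)
pose x0 := (x1 - s * x2) / (1 - s).
have x1E : ccomb (1 - s) x0 x2 = x1.
  by rewrite /ccomb /x0 mulrC mulfVK; [ring|rewrite subr_eq0 gt_eqF].
(* For [b >= 0] and [x <= K], the bound [TL P Lam (K - b) x (cst K) <= K + 1] amounts to
   [b * Lam x <= 1 - Lam x], the hypograph of [(1 - Lam) / Lam]. It is used with [b] equal to 0, [u]
   and [s * u]. *)
pose K := Num.max x0 x2.
have x0K : x0 <= K by rewrite le_max lexx.
have x2K : x2 <= K by rewrite le_max lexx orbT.
have EK b : 0 <= b -> Epos P (cst K) (K - b) = b%:E.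
  by move=> b0; rewrite Epos_cst opprB addrC subrK; congr EFin; apply/max_idPl.
have su0 : 0 <= s * u by apply: mulr_ge0; exact: ltW.
have aE : ccomb (1 - s) K (K - u) = K - s * u by rewrite /ccomb; ring.
have T0 : (TL P Lam K x0 (cst K) <= (K + 1)%:E)%E.
  have E0 : Epos P (cst K) K = 0%:E by have := EK _ (lexx 0); rewrite subr0.
  apply/(TL_le _ _ (lexx 0) E0); have /andP[? ?] := Lam01 x0.
  by split; [lra|lra|rewrite addrC addKr mul1r subr_ge0].
have T2 : (TL P Lam (K - u) x2 (cst K) <= (K + 1)%:E)%E.
  by apply/(TL_le _ _ (ltW u0) (EK _ (ltW u0))); split; [lra|lra|rewrite -/L2; lra].
have s01 : 0 < 1 - s < 1 by lra.
have T01 : (Order.max (TL P Lam K x0 (cst K)) (TL P Lam (K - u) x2 (cst K))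
    <= (K + 1)%:E)%E by rewrite ge_max T0 T2.
have := le_trans (H _ (Linf_cst K) K (K - u) x0 x2 _ s01) T01.
rewrite x1E aE => /(TL_le _ _ su0 (EK _ su0))[_ _].
rewrite -/L1; lra.
Qed.

End Convexity.

(** * Minimum representation of [ESL] and convexity criteria for [TL] *)

Theorem theorem4 (d : measure_display) (Omega : measurableType d) (R : realType)
  (P : probability Omega R) (HP : atomless P)
  (Lam : R -> R)
  (HLam01 : forall x, 0 <= Lam x <= 1)
  (HLamdec : forall x y, x <= y -> Lam y <= Lam x)
  (HLamrc : forall x, Lam @ x^'+ --> Lam x) :
  (* main representation: ES_Lambda(X) = min_{(a,x)} T_Lambda(a,x,X),
     attained at x* = ES_Lambda(X) and the described a* *)
  (forall X, Linf P X ->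
     exists xs : R,
       [/\ ESL P Lam X = xs%:E,
           (forall a x : R, (ESL P Lam X <= TL P Lam a x X)%E),
           (exists a x : R, TL P Lam a x X = ESL P Lam X),
           (Lam xs < 1 -> forall a : R,
               (VaR P X (Lam xs) <= a%:E <= VaRp P X (Lam xs))%E ->
               TL P Lam a xs X = ESL P Lam X) &
           (Lam xs = 1 -> forall a : R, a%:E = VaR P X 1 ->
               TL P Lam a xs X = ESL P Lam X)])
  /\
  (* (i) joint convexity in (a, X) for every x *)
  (forall x : R, forall (a1 a2 : R) (X1 X2 : Omega -> R),
     Linf P X1 -> Linf P X2 -> forall t : R, 0 < t < 1 ->
     (TL P Lam (ccomb t a1 a2) x (ccombf t X1 X2)
        <= t%:E * TL P Lam a1 x X1 + (1 - t)%:E * TL P Lam a2 x X2)%E)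
  /\
  (* (ii) convexity in x for all (a, X) iff x |-> 1/(1 - Lambda x) convex *)
  ((forall (a : R) (X : Omega -> R), Linf P X ->
      convexE (fun x => TL P Lam a x X))
   <-> convexE (invOneMinus Lam))
  /\
  (* (iii) equivalence of (a)-(d) with (e) Lambda constant *)
  (let e := exists c : R, forall x, Lam x = c in
   ((* (a) jointly convex in (a,x) for all X *)
    (forall X : Omega -> R, Linf P X ->
       forall (a1 a2 x1 x2 t : R), 0 < t < 1 ->
       (TL P Lam (ccomb t a1 a2) (ccomb t x1 x2) X
          <= t%:E * TL P Lam a1 x1 X + (1 - t)%:E * TL P Lam a2 x2 X)%E)
    <-> e)
   /\
   ((* (b) jointly quasi-convex in (a,x) for all X *)
    (forall X : Omega -> R, Linf P X ->
       forall (a1 a2 x1 x2 t : R), 0 < t < 1 ->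
       (TL P Lam (ccomb t a1 a2) (ccomb t x1 x2) X
          <= Order.max (TL P Lam a1 x1 X) (TL P Lam a2 x2 X))%E)
    <-> e)
   /\
   ((* (c) jointly convex in (a,x,X) *)
    (forall (X1 X2 : Omega -> R), Linf P X1 -> Linf P X2 ->
       forall (a1 a2 x1 x2 t : R), 0 < t < 1 ->
       (TL P Lam (ccomb t a1 a2) (ccomb t x1 x2) (ccombf t X1 X2)
          <= t%:E * TL P Lam a1 x1 X1 + (1 - t)%:E * TL P Lam a2 x2 X2)%E)
    <-> e)
   /\
   ((* (d) jointly quasi-convex in (a,x,X) *)
    (forall (X1 X2 : Omega -> R), Linf P X1 -> Linf P X2 ->
       forall (a1 a2 x1 x2 t : R), 0 < t < 1 ->
       (TL P Lam (ccomb t a1 a2) (ccomb t x1 x2) (ccombf t X1 X2)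
          <= Order.max (TL P Lam a1 x1 X1) (TL P Lam a2 x2 X2))%E)
    <-> e)).
Proof.
have ccxx t x : ccomb t x x = x by rewrite /ccomb -mulrDl addrC subrK mul1r.
have ccXX t (X : Omega -> R) : ccombf t X X = X by apply/funext => w; exact: ccxx.
split; [|split; [|split]].
- move=> X [mX [M XM]]; exists (fine (ESL P Lam X)); split.
  + exact: (ESL_fin mX XM HLam01).
  + exact: (ESL_TL mX XM HLam01 HLamdec).
  + exact: (TL_ESL_exists mX XM HLam01 HLamdec HLamrc).
  + move=> L1 a; exact: (TL_ESL_lt1 mX XM HLam01 HLamdec HLamrc L1).
  + move=> L1 a; exact: (TL_ESL_1 mX XM HLam01 HLamdec HLamrc L1).
- move=> x a1 a2 X1 X2 X1L X2L t t01.
  have := @TL_conv _ _ _ P _ HLam01 X1 X2 a1 a2 x x t X1L X2L t01.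
  by rewrite ccxx; apply.
- split; first exact: convex_TL_invOneMinus.
  exact: convex_invOneMinus_TL.
- move=> e.
  (* Constancy gives (c), the strongest property; (a), (b) and (d) follow with [X1 = X2] or through
     [conv_le_max]. Conversely each property implies (b), from which [qcst] recovers constancy. *)
  have conv : e -> forall (X1 X2 : Omega -> R), Linf P X1 -> Linf P X2 ->
       forall (a1 a2 x1 x2 t : R), 0 < t < 1 ->
       (TL P Lam (ccomb t a1 a2) (ccomb t x1 x2) (ccombf t X1 X2)
          <= t%:E * TL P Lam a1 x1 X1 + (1 - t)%:E * TL P Lam a2 x2 X2)%E.
    move=> [c Lc] X1 X2 X1L X2L a1 a2 x1 x2 t t01.
    by apply: TL_conv; rewrite ?Lc.
  have qcst := quasiconvex_TL_cst HLam01 ^~ HLamdec.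
  split; [|split; [|split]]; split.
  + move=> H; apply: qcst => X XL a1 a2 x1 x2 t t01.
    by apply: le_trans (H X XL a1 a2 x1 x2 t t01) _; exact: conv_le_max.
  + by move=> he X XL a1 a2 x1 x2 t; have := conv he X X XL XL a1 a2 x1 x2 t; rewrite ccXX.
  + exact: qcst.
  + move=> he X XL a1 a2 x1 x2 t t01.
    apply: le_trans (conv_le_max _ _ t01).
    by have := conv he X X XL XL a1 a2 x1 x2 t t01; rewrite ccXX.
  + move=> H; apply: qcst => X XL a1 a2 x1 x2 t t01.
    apply: le_trans (conv_le_max _ _ t01).
    by have := H X X XL XL a1 a2 x1 x2 t t01; rewrite ccXX.
  + exact: conv.
  + move=> H; apply: qcst => X XL a1 a2 x1 x2 t t01.
    by have := H X X XL XL a1 a2 x1 x2 t t01; rewrite ccXX.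
  + move=> he X1 X2 X1L X2L a1 a2 x1 x2 t t01.
    apply: le_trans (conv_le_max _ _ t01).
    exact: conv.
Qed.
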